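(* Let $p$ be a prime and let $H$ be a problematic $p$-subgroup of $\Sigma_n$. Then $H$ is an elementary abelian $p$-group, and the action of $H$ on $\mathbf n=\{1,\dots,n\}$ is free.
   Context: A partition of $\mathbf n$ is trivial (discrete) if all its classes are singletons, and proper if it has more than one class. $\mathcal P_n$ is the nerve of the poset of proper nontrivial partitions of $\mathbf n$ ordered by coarsening, with its natural action of the symmetric group $\Sigma_n$. A subgroup $H\subseteq\Sigma_n$ is called problematic if the fixed point space $(\mathcal P_n)^H$ is not contractible (the empty space is not contractible). The trivial group counts as an elementary abelian $p$-group. *)

(* Defs.v *)
From HB Require Import structures.
From mathcomp Require Import all_boot all_order all_algebra all_fingroup.
From mathcomp Require Import all_solvable.

Set Implicit Arguments.
Unset Strict Implicit.
Unset Printing Implicit Defensive.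

Section PartitionPoset.
Local Open Scope nat_scope.
Variable n : nat.

Definition discrete_partition (P : {set {set 'I_n}}) : bool :=
  [forall B in P, #|B| == 1].

Definition proper_nontrivial (P : {set {set 'I_n}}) : bool :=
  [&& partition P [set: 'I_n], 1 < #|P| & ~~ discrete_partition P].

Record ppartition := PPartition {
  ppartition_val :> {set {set 'I_n}};
  ppartitionP : proper_nontrivial ppartition_val }.

HB.instance Definition _ := [isSub for ppartition_val].
HB.instance Definition _ := [Finite of ppartition by <:].

Definition refines (P Q : ppartition) : bool :=
  [forall B in ppartition_val P,
    [exists C in ppartition_val Q, B \subset C]].

Lemma refinesP (P Q : ppartition) :
  reflect (forall B, B \in ppartition_val P ->
             exists2 C, C \in ppartition_val Q & B \subset C)
          (refines P Q).
Proof.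
apply: (iffP forall_inP) => h B /h.
  by case/exists_inP => C; exists C.
by case=> C QC BC; apply/exists_inP; exists C.
Qed.

Lemma ppartition_part (P : ppartition) :
  partition (ppartition_val P) [set: 'I_n].
Proof. by have /and3P[] := ppartitionP P. Qed.

Lemma refines_refl : reflexive refines.
Proof. by move=> P; apply/refinesP => B PB; exists B. Qed.

Lemma refines_trans : transitive refines.
Proof.
move=> Q P S /refinesP PQ /refinesP QS; apply/refinesP => B /PQ[C /QS[D SD CD]].
by move=> BC; exists D => //; apply: subset_trans CD.
Qed.

Lemma refines_sub (P Q : ppartition) :
  refines P Q -> refines Q P -> ppartition_val P \subset ppartition_val Q.
Proof.
move=> /refinesP PQ /refinesP QP; apply/subsetP => B PB.
have [C QC BC] := PQ B PB; have [D PD CD] := QP C QC.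
have [x xB] : exists x, x \in B.
  by apply/set0Pn; apply: partition_neq0 PB; exact: ppartition_part.
have tP := partition_trivIset (ppartition_part P).
have xD : x \in D by apply: (subsetP CD); apply: (subsetP BC).
have DB : D = B by rewrite -(def_pblock tP PD xD) (def_pblock tP PB xB).
suff -> : B = C by [].
by apply/eqP; rewrite eqEsubset BC -DB CD.
Qed.

Lemma refines_anti : antisymmetric refines.
Proof.
move=> P Q /andP[PQ QP]; apply/val_inj/eqP.
by rewrite eqEsubset !refines_sub.
Qed.

Fact coarsening_display : Order.disp_t. Proof. exact: (Order.Disp tt tt). Qed.

HB.instance Definition _ := @Order.Le_isPOrder.Build coarsening_display
  ppartition refines refines_refl refines_anti refines_trans.

Lemma proper_nontrivial_setact (P : {set {set 'I_n}}) (s : 'S_n) :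
  proper_nontrivial P -> proper_nontrivial (('P^*^*)%act P s).
Proof.
case/and3P=> partP cardP ndP; apply/and3P; split.
- have <- : ('P^*)%act [set: 'I_n] s = [set: 'I_n].
    by apply/eqP; rewrite eqEcard subsetT card_setact /=.
  by rewrite /setact imset_partition //; apply: act_inj.
- by rewrite card_setact.
- apply: contra ndP => /forall_inP dP; apply/forall_inP => B PB.
  by rewrite -(card_setact 'P%act B s) dP // mem_setact.
Qed.

Definition ppartition_perm (P : ppartition) (s : 'S_n) : ppartition :=
  PPartition (proper_nontrivial_setact s (ppartitionP P)).

Lemma ppartition_perm1 : ppartition_perm^~ 1%g =1 id.
Proof. by move=> P; apply: val_inj; rewrite /= act1. Qed.

Lemma ppartition_permM (P : ppartition) : act_morph ppartition_perm P.
Proof. by move=> s t; apply: val_inj; rewrite /= actM. Qed.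

Definition ppartition_action : {action 'S_n &-> ppartition} :=
  TotalAction ppartition_perm1 ppartition_permM.

End PartitionPoset.

From mathcomp Require Import all_classical all_reals all_analysis.

Import Order.TTheory GRing.Theory Num.Theory.
Import numFieldNormedType.Exports.

Local Open Scope classical_set_scope.
Local Open Scope ring_scope.

(* The subset A carries the subspace topology. [A a] makes the empty space
   non-contractible, and the values of h off `[0, 1] `*` A are irrelevant. *)
Definition contractible (R : realType) (X : topologicalType) (A : set X) :
    Prop :=
  exists (a : X) (h : R * X -> X),
    [/\ A a,
        {within `[0, 1]%classic `*` A, continuous h},
        (forall s x, `[0, 1]%classic s -> A x -> A (h (s, x))),
        (forall x, A x -> h (0, x) = x) &
        (forall x, A x -> h (1, x) = a)].
Arguments contractible R {X} A.

(* The geometric realization of the nerve of a finite poset T, in barycentric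
   coordinates: the nondegenerate simplices of the nerve are the nonempty chains
   of T, and the point t lies in the open simplex spanned by the chain
   {x | t x <> 0}. As T is finite, the topology of the realization is the one
   induced by the product topology on T -> R. *)
Definition nerve_realization (R : realType) (d : Order.disp_t) (T : finPOrderType d) :
    set {ptws T -> R} :=
  [set t | [/\ (forall x, 0 <= t x),
               \sum_(x : T) t x = 1 &
               (forall x y, t x != 0 -> t y != 0 -> (x >=< y)%O)]].
Arguments nerve_realization R {d} T _.

(* For a (right) action of aT on T, the induced action on realizations is
   (t . s) x = t (x . s^-1), the affine extension of the action on vertices. *)
Definition realization_act (R : realType) (d : Order.disp_t) (T : finPOrderType d)
    (aT : finGroupType) (to : {action aT &-> T}) (t : {ptws T -> R}) (s : aT) :
    {ptws T -> R} :=
  fun x => t (to x s^-1%g).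

Definition realization_fixed (R : realType) (d : Order.disp_t) (T : finPOrderType d)
    (aT : finGroupType) (to : {action aT &-> T}) (H : {set aT}) :
    set {ptws T -> R} :=
  [set t | nerve_realization R T t /\ forall s, s \in H -> realization_act to t s = t].
Arguments realization_fixed R {d T aT} to H _.

Definition problematic (R : realType) (n : nat) (H : {set 'S_n}) : Prop :=
  ~ contractible R (realization_fixed R (ppartition_action n) H).

(* Main.v *)
Require Import Defs.
From mathcomp Require Import all_boot all_order all_algebra all_fingroup.
From mathcomp Require Import all_solvable.

(** A fixed point of [H] in the realization of the nerve is a point whose
   support consists of [H]-invariant partitions: the support is a chain that
   [H] permutes, and an order automorphism of finite order cannot move an
   element to a different comparable one ([realization_fixedE]). So the claim is
   about the poset of [H]-invariant proper nontrivial partitions.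

   Let [K] be a nontrivial normal subgroup of [H] that is never transitive on
   the classes of an [H]-invariant proper partition. Joining an invariant
   partition [P] with the partition into [K]-orbits gives an invariant
   partition [ppartition_join K P], which is nontrivial because it is coarser
   than [P], and proper because it has one class for each [K]-orbit of classes
   of [P]. The orbit partition [C] of [K] itself is proper and nontrivial, being
   the join of [K] with the discrete partition. Thus
   P <= ppartition_join K P >= C,
   and this conical pattern contracts the nerve ([closure_contractible],
   [fixed_contractible]).

   If [H] is a [p]-group but not elementary abelian, its Frattini subgroup
   serves as [K]: were it transitive on the classes of [P], then [H] would be
   the product of ['Phi(H)] and the stabilizer of a class, hence equal to that
   stabilizer, and there would be only one class. If [H] is abelian and a point
   [i] has a nontrivial stabilizer, this stabilizer serves as [K]: it fixes the
   class of [i]. So a problematic [H] has neither. *)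

Set Implicit Arguments.
Unset Strict Implicit.
Unset Printing Implicit Defensive.

(** * Invariant partitions and their join with orbits *)

Section PartitionClasses.
Local Open Scope group_scope.
Variables (aT : finGroupType) (T : finType) (to : {action aT &-> T}).
Implicit Types (P Q : {set {set T}}) (H K : {group aT}).

Lemma mem_pblockT P x : partition P [set: T] -> x \in pblock P x.
Proof. by move=> /cover_partition covP; rewrite mem_pblock covP inE. Qed.

Lemma pblock_memT P x : partition P [set: T] -> pblock P x \in P.
Proof. by move=> /cover_partition covP; rewrite pblock_mem // covP inE. Qed.

Lemma class_pblock P B :
  partition P [set: T] -> B \in P -> exists2 x, x \in B & pblock P x = B.
Proof.
move=> partP PB; have /set0Pn[x xB] := partition_neq0 partP PB.
by exists x => //; apply: def_pblock (partition_trivIset partP) PB xB.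
Qed.

Lemma pblock_preim (rT : eqType) (f : T -> rT) x y :
  (y \in pblock (preim_partition f [set: T]) x) = (f x == f y).
Proof.
rewrite pblock_equivalence_partition ?inE // => u v w _ _ _.
by split=> // /eqP ->.
Qed.

Lemma pblock_act P a x :
    partition P [set: T] -> a \in 'N(P | to^*) ->
  pblock P (to x a) = to^*%act (pblock P x) a.
Proof.
move=> partP nPa; apply: def_pblock (partition_trivIset partP) _ _.
  by rewrite astabs_act // pblock_memT.
by apply: mem_setact; exact: mem_pblockT.
Qed.

Lemma acts_pblock P H :
    partition P [set: T] ->
    (forall a, a \in H ->
       {homo to^~ a : x y / y \in pblock P x >-> y \in pblock P x}) ->
  [acts H, on P | to^*].
Proof.
move=> partP homP; apply/subsetP => a aH; rewrite !inE.
apply/subsetP => _ /(class_pblock partP)[x _ <-]; rewrite inE.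
suff -> : to^*%act (pblock P x) a = pblock P (to x a) by rewrite pblock_memT.
apply/setP => z; rewrite -{1}[z](actKV to a).
rewrite (mem_imset _ _ (act_inj to a)); apply/idP/idP => [/(homP a aH)|].
  by rewrite actKV.
by move=> /(homP _ (groupVr aH)); rewrite actK.
Qed.

Lemma card_partition_gt1 P :
    partition P [set: T] ->
  reflect (exists x y, y \notin pblock P x) (1 < #|P|)%N.
Proof.
move=> partP; have tP := partition_trivIset partP.
apply: (iffP card_gt1P) => [[B [C [PB PC BC]]]|[x [y xy]]].
  have [[x xB Bx] [y yC Cy]] := (class_pblock partP PB, class_pblock partP PC).
  exists x, y; apply: contra BC => /(same_pblock tP).
  by rewrite Bx Cy => ->.
exists (pblock P x), (pblock P y); rewrite !pblock_memT //; split=> //.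
by apply: contra xy => /eqP ->; rewrite mem_pblockT.
Qed.

(** When [K] preserves [P], this is the join of [P] and the partition into
   [K]-orbits in the lattice of partitions. Taking the fibers of a function
   gives a partition for every [P]. *)
Definition orbit_join K P : {set {set T}} :=
  preim_partition (fun x => orbit to^* K (pblock P x)) [set: T].

Lemma orbit_join_partition K P : partition (orbit_join K P) [set: T].
Proof. exact: preim_partitionP. Qed.

Lemma pblock_orbit_join K P x y :
    partition P [set: T] -> [acts K, on P | to^*] ->
  reflect (exists2 a, a \in K & y \in pblock P (to x a))
          (y \in pblock (orbit_join K P) x).
Proof.
move=> partP actP; have tP := partition_trivIset partP.
rewrite pblock_preim eq_sym orbit_eq_mem.
apply: (iffP orbitP) => -[a aK xy]; exists a => //; last first.
  by rewrite -pblock_act ?(subsetP actP) // (same_pblock tP xy).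
by rewrite pblock_act ?(subsetP actP) // xy mem_pblockT.
Qed.

Lemma orbit_join_coarsens K P x :
  partition P [set: T] -> pblock P x \subset pblock (orbit_join K P) x.
Proof.
move=> partP; apply/subsetP => y xy.
by rewrite pblock_preim (same_pblock (partition_trivIset partP) xy).
Qed.

Lemma orbit_join_mono K P Q x :
    partition P [set: T] -> [acts K, on P | to^*] ->
    partition Q [set: T] -> [acts K, on Q | to^*] ->
    (forall x, pblock P x \subset pblock Q x) ->
  pblock (orbit_join K P) x \subset pblock (orbit_join K Q) x.
Proof.
move=> partP actP partQ actQ PQ.
apply/subsetP => y /(pblock_orbit_join _ _ partP actP)[a aK xy].
by apply/pblock_orbit_join => //; exists a; rewrite ?(subsetP (PQ _)).
Qed.

(** Normality lets [a] in [H] pass through the [k] in [K] joining two classes: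
   k * a = a * k ^ a. *)
Lemma acts_orbit_join H K P :
    partition P [set: T] -> [acts H, on P | to^*] -> K <| H ->
  [acts H, on orbit_join K P | to^*].
Proof.
move=> partP actP /andP[sKH nKH]; have actKP := subset_trans sKH actP.
apply: acts_pblock => [|a aH y x]; first exact: orbit_join_partition.
case/pblock_orbit_join => // k kK xy; apply/pblock_orbit_join => //.
exists (k ^ a); first by rewrite memJ_norm ?(subsetP nKH).
rewrite -actM -conjgC actM pblock_act ?(subsetP actP) //.
by rewrite mem_setact.
Qed.

(** The classes of the join correspond to the orbits of [K] on the classes
   of [P]. *)
Lemma orbit_join_gt1 K P :
    partition P [set: T] -> [acts K, on P | to^*] -> (1 < #|P|)%N ->
    ~~ [transitive K, on P | to^*] ->
  (1 < #|orbit_join K P|)%N.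
Proof.
move=> partP actP ltP; apply: contraR => le1.
have one x y : y \in pblock (orbit_join K P) x.
  apply: contraR le1 => xy.
  by apply/(card_partition_gt1 (orbit_join_partition _ _)); exists x, y.
have [B PB] : exists B, B \in P by apply/set0Pn; rewrite -card_gt0 ltnW.
apply/imsetP; exists B => //.
apply/setP => C; apply/idP/idP => [PC|/orbitP[a aK <-]]; last first.
  by rewrite astabs_act // (subsetP actP).
have [[x _ <-] [y _ <-]] := (class_pblock partP PB, class_pblock partP PC).
by have := one y x; rewrite pblock_preim orbit_eq_mem.
Qed.

End PartitionClasses.

Section OrbitJoinSn.
Variable n : nat.
Local Open Scope group_scope.
Implicit Types (P Q : ppartition n) (H K : {group 'S_n}).

Lemma discrete_partitionPn (P : {set {set 'I_n}}) :
    partition P [set: 'I_n] ->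
  reflect (exists x y, x != y /\ y \in pblock P x) (~~ discrete_partition P).
Proof.
move=> partP; apply: (iffP forall_inPn) => [[B PB B1]|[x [y [neq xy]]]].
  have [x xB Bx] := class_pblock partP PB.
  rewrite (cardsD1 x) xB in B1.
  have /set0Pn[y] : B :\ x != set0 by rewrite -cards_eq0.
  by rewrite !inE => /andP[yx yB]; exists x, y; rewrite eq_sym Bx.
exists (pblock P x); first exact: pblock_memT.
apply/cards1P => -[z Pz]; move: xy (mem_pblockT x partP) neq.
by rewrite Pz !inE => /eqP -> /eqP ->; rewrite eqxx.
Qed.

Lemma refines_pblock P Q :
  reflect (forall x, pblock P x \subset pblock Q x) (refines P Q).
Proof.
have [partP partQ] := (ppartition_part P, ppartition_part Q).
apply: (iffP (refinesP P Q)) => [PQ x|PQ B PB].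
  have [C QC PC] := PQ _ (pblock_memT x partP).
  rewrite (def_pblock (partition_trivIset partQ) QC) //.
  by rewrite (subsetP PC) ?mem_pblockT.
have [x _ <-] := class_pblock partP PB.
by exists (pblock Q x); rewrite ?pblock_memT.
Qed.

Lemma ppartition_fixedP P H :
  reflect (forall s, s \in H -> ppartition_action n P s = P)
          [acts H, on val P | 'P^*].
Proof.
rewrite -astab1_set.
apply: (iffP subsetP) => [fixP s /fixP/astab1P Ps|fixP s /fixP Ps].
  by apply: val_inj.
by apply/astab1P; rewrite -[RHS]/(val P) -[in RHS]Ps.
Qed.

(** The default value [P] only occurs when the join is not proper, which
   [val_ppartition_join] rules out in the case at hand. *)
Definition ppartition_join K P : ppartition n :=
  insubd P (orbit_join 'P K (val P)).

Definition intransitive_on_classes H K :=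
  forall P : {set {set 'I_n}}, partition P [set: 'I_n] -> (1 < #|P|)%N ->
    [acts H, on P | 'P^*] -> ~~ [transitive K, on P | 'P^*].

Section Join.
Variables H K : {group 'S_n}.
Hypotheses (nKH : K <| H) (ntK : K :!=: 1).
Hypothesis intrK : intransitive_on_classes H K.

Lemma val_ppartition_join P : [acts H, on val P | 'P^*] ->
  val (ppartition_join K P) = orbit_join 'P K (val P).
Proof.
move=> actP; rewrite val_insubd; have /and3P[partP gt1P ndP] := ppartitionP P.
have actK := subset_trans (normal_sub nKH) actP.
rewrite ifT //; apply/and3P; split; first exact: orbit_join_partition.
  by apply: orbit_join_gt1 => //; apply: intrK.
have [x [y [neq xy]]] := discrete_partitionPn partP ndP.
apply/discrete_partitionPn; first exact: orbit_join_partition.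
by exists x, y; split; rewrite ?(subsetP (orbit_join_coarsens _ _ _ partP)).
Qed.

Let discr : {set {set 'I_n}} := preim_partition id [set: 'I_n].

(** The join with [K] is monotone, so it is least on the discrete partition,
   where it is the partition into [K]-orbits. The discrete partition is not a
   vertex of the nerve, hence the detour through [orbit_join]. *)
Lemma orbit_partition :
  exists2 C : ppartition n, [acts H, on val C | 'P^*] &
    forall P, [acts H, on val P | 'P^*] -> refines C (ppartition_join K P).
Proof.
have partD : partition discr [set: 'I_n] by apply: preim_partitionP.
have actD (G : {group 'S_n}) : [acts G, on discr | 'P^*].
  by apply: acts_pblock => // a _ x y /=; rewrite !pblock_preim => /eqP ->.
have /trivgPn[k kK k1] := ntK.
have [x xk] : exists x, k x != x.
  apply/existsP; apply: contraR k1 => /existsPn fixk.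
  by apply/eqP/permP => x; rewrite perm1; apply/eqP/negPn/fixk.
have propC : proper_nontrivial (orbit_join 'P K discr).
  apply/and3P; split; first exact: orbit_join_partition.
    have gt1D : (1 < #|discr|)%N.
      apply/card_partition_gt1 => //; exists x, (k x).
      by rewrite pblock_preim eq_sym.
    exact: orbit_join_gt1 partD (actD K) gt1D (intrK partD gt1D (actD H)).
  apply/discrete_partitionPn; first exact: orbit_join_partition.
  exists x, (k x); split; first by rewrite eq_sym.
  apply/(pblock_orbit_join _ _ partD (actD K)).
  by exists k; rewrite ?pblock_preim.
exists (PPartition propC) => [|P actP]; first exact: acts_orbit_join.
apply/refines_pblock => y; rewrite val_ppartition_join //=.
have actK := subset_trans (normal_sub nKH) actP.
apply: orbit_join_mono => //; first exact: ppartition_part.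
move=> z; apply/subsetP => t; rewrite pblock_preim => /eqP <-.
by rewrite mem_pblockT ?ppartition_part.
Qed.

Lemma ppartition_join_acts P : [acts H, on val P | 'P^*] ->
  [acts H, on val (ppartition_join K P) | 'P^*].
Proof.
by move=> actP; rewrite val_ppartition_join // acts_orbit_join ?ppartition_part.
Qed.

Lemma refines_join P : [acts H, on val P | 'P^*] ->
  refines P (ppartition_join K P).
Proof.
move=> actP; apply/refines_pblock => x; rewrite val_ppartition_join //.
exact: (orbit_join_coarsens _ _ _ (ppartition_part P)).
Qed.

Lemma join_mono P Q :
    [acts H, on val P | 'P^*] -> [acts H, on val Q | 'P^*] -> refines P Q ->
  refines (ppartition_join K P) (ppartition_join K Q).
Proof.
move=> actP actQ /refines_pblock PQ; have sKH := normal_sub nKH.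
apply/refines_pblock => x; rewrite !val_ppartition_join //.
by apply: orbit_join_mono => //;
  rewrite ?ppartition_part // (subset_trans sKH).
Qed.

End Join.

(** The Frattini argument for actions turns transitivity of ['Phi(H)] into a
   factorization of [H] through the stabilizer of a class, and elements of
   ['Phi(H)] are superfluous in any generating set of [H]. *)
Lemma Frattini_intransitive H : intransitive_on_classes H 'Phi(H).
Proof.
move=> P partP gt1P actP; apply/negP => trP.
have [B PB] : exists B, B \in P by apply/set0Pn; rewrite -card_gt0 ltnW.
have trH : [transitive H, on P | 'P^*].
  apply/imsetP; exists B => //; apply/eqP.
  rewrite eqEsubset acts_sub_orbit // PB andbT.
  by rewrite -(atransP trP _ PB) imsetS ?Phi_sub.
have /(subgroup_transitiveP PB (Phi_sub H) trH) defH := trP.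
have stabH : 'C_H[B | 'P^*] = H.
  rewrite -[LHS]genGid; apply: Phi_nongen.
  by rewrite joingC /= -[RHS]defH norm_joinEl // subIset // gFnorm.
have := atransP trH _ PB; rewrite (orbit1P _).
  by move=> P1; rewrite -P1 cards1 in gt1P.
by apply/afixP => a; rewrite -{1}stabH => /setIP[_ /astab1P].
Qed.

(** The stabilizer of [i] fixes the class of [i], so this class would be the
   only one. *)
Lemma stabilizer_intransitive H i : intransitive_on_classes H 'C_H[i | 'P].
Proof.
move=> P partP gt1P actP; apply/negP => trP.
have := atransP trP _ (pblock_memT i partP); rewrite (orbit1P _).
  by move=> P1; rewrite -P1 cards1 in gt1P.
apply/afixP => a /setIP[aH /astab1P ai].
by rewrite -pblock_act ?ai // (subsetP actP).
Qed.

End OrbitJoinSn.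

(** * Continuity for the product topology *)

From mathcomp Require Import all_classical all_reals all_analysis.
From mathcomp Require Import lra.

Import Order.TTheory GRing.Theory Num.Theory.
Import numFieldNormedType.Exports.

Local Open Scope classical_set_scope.
Local Open Scope ring_scope.

Lemma continuous_ptws (I : Type) (X Y : topologicalType)
    (h : X -> {ptws I -> Y}) :
  (forall i, continuous (fun x => h x i)) -> continuous h.
Proof.
move=> ch x; apply/cvg_sup => i.
by move: x; apply: continuous_comp_initial; apply: ch.
Qed.

Lemma continuous_ptws_eval (I : eqType) (Y : topologicalType) (i : I) :
  continuous (fun t : {ptws I -> Y} => t i).
Proof. exact: (@proj_continuous I (fun=> Y) i). Qed.

Section RealContinuity.
Variables (R : realType) (X : topologicalType).
Implicit Types f g : X -> R.

Lemma continuous_add f g :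
  continuous f -> continuous g -> continuous (fun x => f x + g x).
Proof. by move=> cf cg x; apply: continuousD; [apply: cf | apply: cg]. Qed.

Lemma continuous_sub f g :
  continuous f -> continuous g -> continuous (fun x => f x - g x).
Proof. by move=> cf cg x; apply: continuousB; [apply: cf | apply: cg]. Qed.

Lemma continuous_mul f g :
  continuous f -> continuous g -> continuous (fun x => f x * g x).
Proof. by move=> cf cg x; apply: continuousM; [apply: cf | apply: cg]. Qed.

Lemma continuous_minr f g :
  continuous f -> continuous g -> continuous (fun x => Num.min (f x) (g x)).
Proof. by move=> cf cg x; apply: continuous_min; [apply: cf | apply: cg]. Qed.

Lemma continuous_maxr f g :
  continuous f -> continuous g -> continuous (fun x => Num.max (f x) (g x)).
Proof. by move=> cf cg x; apply: continuous_max; [apply: cf | apply: cg]. Qed.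

Lemma continuous_sumr (I : finType) (P : pred I) (F : I -> X -> R) :
  (forall i, continuous (F i)) -> continuous (fun x => \sum_(i | P i) F i x).
Proof.
move=> cF x; apply: cvg_big => [|i _]; [exact: add_continuous | exact: cF].
Qed.

End RealContinuity.

(** * Contracting a realization along a closure operator *)

(** Let [f] be monotone and inflationary on the subposet [A], with all values
   above [c]. Moving the mass of [t] linearly from [x] to [f x] may leave
   the nerve: for x < y in the support, y and f x need not be comparable. The
   mass is therefore drained from the top of the chain downwards: when some mass
   has left [y] and some mass is still at [x], then x <= y <= f y. Once all mass
   is at values of [f], it is comparable to [c] and flows linearly to [c]. *)
Section ClosureContraction.
Variables (R : realType) (d : Order.disp_t) (T : finPOrderType d).
Variables (A : pred T) (f : T -> T) (c : T).
Hypotheses (Ac : A c) (Af : forall x, A x -> A (f x)).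
Hypothesis f_mono : forall x y, A x -> A y -> (x <= y)%O -> (f x <= f y)%O.
Hypothesis f_ge : forall x, A x -> (x <= f x)%O.
Hypothesis f_c : forall x, A x -> (c <= f x)%O.
Implicit Types (x y z : T) (t : {ptws T -> R}) (s : R).

Definition supported_realization : set {ptws T -> R} :=
  [set t | nerve_realization R T t /\ forall x, t x != 0 -> A x].

Definition mass_above t x : R := \sum_(y | (x < y)%O) t y.

(** The masses are stacked, the largest element of the chain at the bottom, so
   that [x] fills the interval from [mass_above t x] to [mass_above t x + t x];
   what lies below height [s] has been moved. *)
Definition moved s t x : R := Num.min (t x) (Num.max 0 (s - mass_above t x)).

Definition slide s t : {ptws T -> R} :=
  fun z => (t z - moved s t z) + \sum_(x | f x == z) moved s t x.

Definition cone_time s : R := Num.max 0 (2 * s - 1).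

(** The draining runs at double speed and needs no clamping at time 1/2: once
   [s] exceeds the total mass 1, [moved] no longer depends on it. *)
Definition closure_homotopy (st : R * {ptws T -> R}) : {ptws T -> R} :=
  fun z => (1 - cone_time st.1) * slide (2 * st.1) st.2 z
           + cone_time st.1 * (z == c)%:R.

Lemma continuous_closure_homotopy : continuous closure_homotopy.
Proof.
have c_s : continuous (fun st : R * {ptws T -> R} => st.1).
  by move=> st; apply: cvg_fst.
have c_t x : continuous (fun st : R * {ptws T -> R} => st.2 x).
  move=> st; apply: (@continuous_comp _ _ _ snd (fun t : {ptws T -> R} => t x)).
    exact: cvg_snd.
  exact: continuous_ptws_eval.
have c_2s : continuous (fun st : R * {ptws T -> R} => 2 * st.1).
  by apply: continuous_mul => //; apply: cst_continuous.
have c_m x : continuous (fun st : R * {ptws T -> R} => moved (2 * st.1) st.2 x).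
  apply: continuous_minr => //.
  apply: continuous_maxr; first exact: cst_continuous.
  by apply: continuous_sub => //; apply: continuous_sumr.
have c_c : continuous (fun st : R * {ptws T -> R} => cone_time st.1).
  apply: continuous_maxr; first exact: cst_continuous.
  by apply: continuous_sub => //; apply: cst_continuous.
apply: continuous_ptws => z; apply: continuous_add; apply: continuous_mul => //.
- by apply: continuous_sub => //; apply: cst_continuous.
- apply: continuous_add; first exact: continuous_sub.
  exact: continuous_sumr.
- exact: cst_continuous.
Qed.

Section Realization.
Variable t : {ptws T -> R}.
Hypothesis At : supported_realization t.

Let t_ge0 x : 0 <= t x. Proof. by case: At => -[]. Qed.
Let t_sum : \sum_x t x = 1. Proof. by case: At => -[]. Qed.
Let t_chain x y : t x != 0 -> t y != 0 -> (x >=< y)%O.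
Proof. by case: At => -[_ _ +] _; apply. Qed.
Let t_supp x : t x != 0 -> A x. Proof. by case: At => _; apply. Qed.

Lemma moved_ge0 s x : 0 <= moved s t x.
Proof. by rewrite /moved le_min t_ge0 le_max lexx. Qed.

Lemma moved_le s x : moved s t x <= t x.
Proof. by rewrite /moved ge_min lexx. Qed.

Lemma moved_neq0 s x : moved s t x != 0 -> t x != 0 /\ mass_above t x < s.
Proof.
move=> m0; split.
  by apply: contraNneq m0 => tx0; rewrite eq_le moved_ge0 -{1}tx0 moved_le.
rewrite ltNge; apply: contraNN m0 => le_s.
rewrite eq_le moved_ge0 andbT /moved ge_min ge_max lexx /=.
by rewrite subr_le0 le_s orbT.
Qed.

Lemma kept_neq0 s x : t x - moved s t x != 0 ->
  t x != 0 /\ s < mass_above t x + t x.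
Proof.
move=> k0; split.
  apply: contraNneq k0 => tx0; rewrite subr_eq0 eq_sym.
  by rewrite eq_le moved_le tx0 moved_ge0.
rewrite ltNge; apply: contraNN k0 => le_s.
rewrite subr_eq0 eq_le moved_le andbT /moved le_min lexx /= le_max.
by rewrite lerBrDl le_s orbT.
Qed.

(** If y < x, the stack interval of [x] ends at or below the start of that of
   [y], so [x] is emptied before [y] starts to lose mass. *)
Lemma kept_le_moved s x y :
  t x - moved s t x != 0 -> moved s t y != 0 -> (x <= y)%O.
Proof.
move=> /kept_neq0[tx sx] /moved_neq0[ty sy].
have /orP[//|yx] := t_chain tx ty; have [->//|neq] := eqVneq x y.
suff : mass_above t x + t x <= mass_above t y.
  by move=> /(lt_le_trans sx)/lt_trans/(_ sy); rewrite ltxx.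
have yltx : (y < x)%O by rewrite lt_neqAle eq_sym neq.
have -> : mass_above t y = t x + \sum_(z | (y < z)%O && (z != x)) t z.
  by rewrite /mass_above (bigD1 x).
rewrite addrC lerD2l /mass_above big_mkcond [X in _ <= X]big_mkcond.
apply: ler_sum => z _; case: ifP => xz; last by case: ifP.
by rewrite (lt_trans yltx xz) /= (gt_eqF xz).
Qed.

Lemma moved_at_1 s x : 1 <= s -> moved s t x = t x.
Proof.
move=> s1; apply: min_idPl; rewrite le_max; apply/orP; right.
have : \sum_(z | z != x) t z = 1 - t x.
  by rewrite -t_sum [in RHS](bigD1 x) //= addrAC subrr add0r.
suff : mass_above t x <= \sum_(z | z != x) t z by move=> + e; rewrite e; lra.
rewrite /mass_above big_mkcond [X in _ <= X]big_mkcond.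
apply: ler_sum => z _; case: ifP => xz; last by case: ifP.
by rewrite (gt_eqF xz).
Qed.

Lemma slide_ge0 s z : 0 <= slide s t z.
Proof.
by rewrite addr_ge0 ?subr_ge0 ?moved_le // sumr_ge0 // => x _; apply: moved_ge0.
Qed.

Lemma slide_sum s : \sum_z slide s t z = 1.
Proof.
rewrite big_split /= sumrB t_sum (exchange_big_dep xpredT) //=.
rewrite [X in _ + X](eq_bigr (moved s t)) ?subrK // => x _.
by rewrite (big_pred1 (f x)) // => z; rewrite eq_sym.
Qed.

Lemma slide_neq0 s z : slide s t z != 0 ->
  (t z - moved s t z != 0) \/ (exists2 x, f x = z & moved s t x != 0).
Proof.
have [k0|] := eqVneq (t z - moved s t z) 0; last by left.
rewrite /slide k0 add0r => m0; right; apply: contrapT => nex.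
case/eqP: m0; apply: big1 => x /eqP fxz; apply/eqP/negPn/negP => mx.
by apply: nex; exists x.
Qed.

Lemma slide_supp s z : slide s t z != 0 -> A z.
Proof.
case/slide_neq0 => [/kept_neq0[/t_supp]//|[x <- /moved_neq0[/t_supp/Af]//]].
Qed.

Lemma slide_chain s y z : slide s t y != 0 -> slide s t z != 0 -> (y >=< z)%O.
Proof.
have mixed x w : t w - moved s t w != 0 -> moved s t x != 0 -> (w <= f x)%O.
  move=> kw mx; apply: le_trans (kept_le_moved kw mx) (f_ge _).
  by have [/t_supp] := moved_neq0 mx.
move=> /slide_neq0[ky|[x <- mx]] /slide_neq0[kz|[x' <- mx']].
- by apply: t_chain; [have [] := kept_neq0 ky | have [] := kept_neq0 kz].
- by rewrite /Order.comparable mixed.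
- by rewrite /Order.comparable mixed ?orbT.
have [[tx _] [tx' _]] := (moved_neq0 mx, moved_neq0 mx').
rewrite /Order.comparable; have /orP[le_x|le_x] := t_chain tx tx'.
  by rewrite f_mono ?t_supp.
by rewrite [X in _ || X]f_mono ?t_supp ?orbT.
Qed.

Lemma slide_1_ge s z : 1 <= s -> slide s t z != 0 -> (c <= z)%O.
Proof.
move=> s1 /slide_neq0[|[x <- /moved_neq0[/t_supp/f_c]//]].
by rewrite moved_at_1 // subrr eqxx.
Qed.

End Realization.

Lemma cone_time_ge0 s : 0 <= cone_time s.
Proof. by rewrite le_max lexx. Qed.

Lemma cone_time_le1 s : s <= 1 -> cone_time s <= 1.
Proof. by move=> s1; rewrite ge_max ler01 /=; lra. Qed.

Lemma cone_time_neq0 s : cone_time s != 0 -> 1 <= 2 * s.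
Proof.
apply: contraNT; rewrite -ltNge => s1; apply/eqP/max_idPl; lra.
Qed.

Lemma closure_homotopy_in s t : 0 <= s <= 1 -> supported_realization t ->
  supported_realization (closure_homotopy (s, t)).
Proof.
move=> /andP[s0 s1] At.
have cone_ge0 := cone_time_ge0 s; have cone_le1 := cone_time_le1 s1.
have supp z : closure_homotopy (s, t) z != 0 ->
    slide (2 * s) t z != 0 \/ (z = c /\ cone_time s != 0).
  have [s0z|] := eqVneq (slide (2 * s) t z) 0; last by left.
  rewrite /closure_homotopy /= s0z mulr0 add0r mulf_eq0 negb_or pnatr_eq0.
  by rewrite eqb0 negbK => /andP[cs /eqP zc]; right.
have c_chain z : cone_time s != 0 -> slide (2 * s) t z != 0 -> (c <= z)%O.
  by move=> /cone_time_neq0 /(slide_1_ge At); apply.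
split; last first.
  by move=> z /supp[/(slide_supp At)//|[-> _]].
split=> [z||y z /supp[sy|[-> cs]] /supp[sz|[-> cs']]].
- by rewrite addr_ge0 // mulr_ge0 ?ler0n ?subr_ge0 ?slide_ge0.
- rewrite big_split -!mulr_sumr /= slide_sum // (bigD1 c) //= eqxx big1.
    by rewrite addr0 !mulr1 subrK.
  by move=> z /negPf ->.
- exact: slide_chain sy sz.
- by rewrite /Order.comparable c_chain ?orbT.
- by rewrite /Order.comparable c_chain.
- by rewrite comparablexx.
Qed.

Lemma closure_contractible : contractible R supported_realization.
Proof.
exists (fun z => (z == c)%:R : R), closure_homotopy; split.
- split; last by move=> x; rewrite pnatr_eq0 eqb0 negbK => /eqP ->.
  split=> [x||x y]; first exact: ler0n.
    by rewrite (bigD1 c) //= eqxx big1 ?addr0 // => x /negPf ->.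
  by rewrite !pnatr_eq0 !eqb0 !negbK => /eqP -> /eqP ->; rewrite comparablexx.
- exact/continuous_subspaceT/continuous_closure_homotopy.
- by move=> s t; rewrite /= in_itv /=; apply: closure_homotopy_in.
- move=> t At; apply: functional_extensionality_dep => z.
  have cone0 : cone_time 0 = 0 by apply/max_idPl; lra.
  have moved0 x : moved 0 t x = 0.
    apply/eqP/negPn/negP => /(moved_neq0 At)[_]; rewrite ltNge => /negP; apply.
    by apply: sumr_ge0 => y _; case: At => -[].
  rewrite /closure_homotopy /= cone0 mulr0 /slide moved0 big1 => [|x _ //].
  by rewrite subr0 mul0r subr0 !addr0 mul1r.
- move=> t At; apply: functional_extensionality_dep => z.
  have cone1 : cone_time 1 = 1 by rewrite /cone_time max_r; lra.
  by rewrite /closure_homotopy /= cone1 subrr mul0r mul1r add0r.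
Qed.

End ClosureContraction.

(** * Fixed points of a realization *)

Section FixedRealization.
Variables (R : realType) (d : Order.disp_t) (T : finPOrderType d).
Variables (aT : finGroupType) (to : {action aT &-> T}) (H : {group aT}).
Hypothesis homo_to : forall a, a \in H -> {homo to^~ a : x y / (x <= y)%O}.

(** Iterating x <= x . a around the cycle of [a] returns to [x]. *)
Lemma act_ge_fixed a x : a \in H -> (x <= to x a)%O -> to x a = x.
Proof.
move=> aH le_xa; apply/eqP; rewrite eq_le le_xa andbT.
have iter_ge k : (to x a <= to x (a ^+ k.+1)%g)%O.
  elim: k => [|k IH]; first by rewrite expg1.
  rewrite expgS actM; apply: le_trans IH _.
  by apply: homo_to le_xa; rewrite groupX.
have := iter_ge #[a]%g.-1; rewrite prednK ?order_gt0 //.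
by rewrite expg_order act1.
Qed.

Lemma comparable_act_fixed a x : a \in H -> (x >=< to x a)%O -> to x a = x.
Proof.
move=> aH /orP[/act_ge_fixed->//|le_ax].
have := @act_ge_fixed a^-1%g (to x a) (groupVr aH).
by rewrite actK => /(_ le_ax).
Qed.

(** A fixed [t] has the same mass at [x] and at [x . a], so when this mass is
   nonzero the two are comparable, hence equal. *)
Lemma realization_fixedE :
  realization_fixed R to H =
  supported_realization (R := R) [pred x | x \in ('Fix_to(H))%g].
Proof.
apply/seteqP; split=> t [nt tH]; split=> //.
  move=> x tx; apply/afixP => a aH; apply: comparable_act_fixed => //.
  case: nt => _ _; apply=> //.
  have <- : realization_act to t a (to x a) = t (to x a) by rewrite tH.
  by rewrite /realization_act /= actK.
move=> a aH; apply: functional_extensionality_dep => x.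
rewrite /realization_act.
have [fx|nfx] := boolP (x \in ('Fix_to(H))%g).
  by rewrite (afixP fx) ?groupV.
have /eqP -> : t x == 0 by apply: contraNT nfx => /tH.
apply/eqP; apply: contraNT nfx => /tH /= /afixP fxa.
have := fxa a aH; rewrite actKV => xa.
by apply/afixP => b bH; rewrite xa fxa.
Qed.

End FixedRealization.

(** * Problematic p-subgroups *)

Lemma ppartition_perm_mono n (s : 'S_n) :
  {homo (ppartition_action n)^~ s : P Q / (P <= Q)%O}.
Proof.
move=> P Q /refinesP PQ; apply/refinesP => _ /imsetP[B PB ->].
have [C QC BC] := PQ B PB.
by exists ('P^*%act C s)%g; [apply: mem_setact | apply: imsetS].
Qed.

Lemma fixed_contractible (R : realType) n (H K : {group 'S_n}) :
    normal K H -> (K :!=: 1)%g -> intransitive_on_classes H K ->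
  contractible R (realization_fixed R (ppartition_action n) H).
Proof.
move=> nKH ntK intrK; have [C actC C_le] := orbit_partition nKH ntK intrK.
have fixE P : (P \in ('Fix_(ppartition_action n)(H))%g) =
              [acts H, on val P | 'P^*]%g.
  by apply/afixP/ppartition_fixedP.
rewrite realization_fixedE => [|s _]; last exact: ppartition_perm_mono.
apply: (@closure_contractible _ _ _ _ (ppartition_join K) C) => /=.
- by rewrite fixE.
- by move=> P; rewrite !fixE; apply: ppartition_join_acts.
- by move=> P Q; rewrite !fixE; apply: join_mono.
- by move=> P; rewrite fixE; apply: refines_join.
- by move=> P; rewrite fixE; apply: C_le.
Qed.

Theorem proposition6p2 (R : realType) (n p : nat) (H : {group 'S_n})
    (p_prime : prime p) (pH : (p.-group H)%g) (H_problematic : problematic R H) :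
  (p.-abelem H)%g /\ (forall i : 'I_n, 'C_H[i | 'P]%g = 1%g).
Proof.
have abelH : (p.-abelem H)%g.
  rewrite -(trivg_Phi pH); apply/negPn/negP => ntPhi; apply: H_problematic.
  exact: fixed_contractible (Phi_normal H) ntPhi (@Frattini_intransitive _ H).
split=> // i; apply/eqP/negPn/negP => ntC; apply: H_problematic.
have nCH : normal ('C_H[i | 'P])%g H.
  by rewrite -(sub_abelian_normal _ (abelem_abelian abelH)) subsetIl.
exact: fixed_contractible nCH ntC (@stabilizer_intransitive _ H i).
Qed.
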